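(* Let $m$ be a positive integer, let $s^{-1}(m)=\max\{n\ge 0: s_n\le m\}$, and let $\phi(m)$ be the sum of the coefficients $\varepsilon_i$ in the $\mu$-expansion $m=r+\varepsilon_1\mu_1+\cdots+\varepsilon_\ell\mu_\ell$ of $m$. Then there exists an integer $r\in\{0,1,2,3,4\}$ such that \[ m-r=3s^{-1}(m)+2\phi(m). \]
   Context: Sequence $s_n$: let $A_1=(5)$ and for $k\ge2$ let $A_k$ be the concatenation $A_{k-1},A_{k-1},(1)$; $A$ is the limiting infinite list; $a_0=0$, $a_n$ is the $n$th entry of $A$ for $n\ge1$, and $s_n=a_0+\cdots+a_n$. For $i\ge1$ let $M_i=2^i-1$ and $\mu_i=3M_i+2=3\cdot 2^i-1$. The $\mu$-expansion of a positive integer $n$ is obtained greedily: if $n\le 4$, stop (remainder $r=n$, no further terms). Otherwise let $\ell=\max\{i:n\ge\mu_i\}$ and write $n=\mu_\ell+r'$ with $0\le r'\le\mu_\ell$; if $r'=0$, stop with $n=\mu_\ell$; if $r'=\mu_\ell$, stop with $n=2\mu_\ell$; otherwise continue the process with $r'$. This yields $n=r+\varepsilon_1\mu_1+\cdots+\varepsilon_\ell\mu_\ell$ with $r\in\{0,1,2,3,4\}$ and $\varepsilon_i\in\{0,1,2\}$ (and $\phi(n)=0$ if $n\le 4$). *)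

(* Defs.v *)
From mathcomp Require Import all_boot all_order all_algebra.
From mathcomp Require Import zify.

Set Implicit Arguments.
Unset Strict Implicit.
Unset Printing Implicit Defensive.

(* A_k for k >= 1; the value at k = 0 is a dummy. *)
Fixpoint blockA (k : nat) : seq nat :=
  match k with
  | 0 => [::]
  | 1 => [:: 5]
  | k'.+1 => blockA k' ++ blockA k' ++ [:: 1]
  end.

(* The n-th entry (counting from 1) of the limit list A is read off in A_n,
   which has 2^n - 1 >= n entries; by a_blockA any A_k with at least n entries
   gives the same value. *)
Definition a (n : nat) : nat :=
  if n is n'.+1 then nth 0 (blockA n) n' else 0.

Definition s (n : nat) : nat := \sum_(0 <= i < n.+1) a i.

Lemma blockASS k : blockA k.+2 = blockA k.+1 ++ blockA k.+1 ++ [:: 1].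
Proof. by []. Qed.

Lemma size_blockA k : size (blockA k) = 2 ^ k - 1.
Proof.
elim: k => [|[|k] IH] //.
rewrite blockASS !size_cat IH /= [in RHS]expnS.
have : 0 < 2 ^ k.+1 by rewrite expn_gt0.
lia.
Qed.

Lemma nth_blockAS k i : i < size (blockA k) ->
  nth 0 (blockA k.+1) i = nth 0 (blockA k) i.
Proof. by case: k => [|k] // ik; rewrite blockASS nth_cat ik. Qed.

Lemma nth_blockA k k' i : k <= k' -> i < size (blockA k) ->
  nth 0 (blockA k') i = nth 0 (blockA k) i.
Proof.
move=> /subnK <- ik; elim: (k' - k) => [|d IH] //.
rewrite addSn nth_blockAS // size_blockA.
move: ik; rewrite size_blockA => ik; apply: leq_trans ik _.
by rewrite leq_sub2r // leq_exp2l // leq_addl.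
Qed.

Lemma leq_size_blockA n : n <= size (blockA n).
Proof. by rewrite size_blockA; have := ltn_expl n (isT : 1 < 2); lia. Qed.

Lemma a_blockA k n : 0 < n <= size (blockA k) -> a n = nth 0 (blockA k) n.-1.
Proof.
case: n => [|n] //= nk; have nn := leq_size_blockA n.+1.
have [kn|/ltnW nk'] := leqP n.+1 k; first by rewrite (nth_blockA kn).
by rewrite -/(blockA n.+1) (nth_blockA nk').
Qed.

Lemma blockA_gt0 k : all (leq 1) (blockA k).
Proof. by elim: k => [|[|k] IH] //; rewrite blockASS !all_cat IH. Qed.

Lemma a_gt0 n : 0 < n -> 0 < a n.
Proof.
case: n => [|n] // _; apply: (allP (blockA_gt0 n.+1)).
exact/mem_nth/leq_size_blockA.
Qed.

Lemma leq_s n : n <= s n.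
Proof.
rewrite /s; elim: n => [|n IH] //.
by rewrite big_nat_recr // -[X in X <= _]addn1 leq_add // a_gt0.
Qed.

Lemma s_leq_ex m : exists n, s n <= m.
Proof. by exists 0; rewrite /s big_nat1. Qed.

Lemma s_leq_bound m n : s n <= m -> n <= m.
Proof. exact/leq_trans/leq_s. Qed.

Definition s_inv (m : nat) : nat := ex_maxn (s_leq_ex m) (@s_leq_bound m).

Definition M (i : nat) : nat := 2 ^ i - 1.

Definition mu (i : nat) : nat := 3 * M i + 2.

(* max {i >= 1 | mu i <= n}, and 0 if n <= 4; the range i <= n suffices since
   i <= mu i (see mu_top_max). *)
Definition mu_top (n : nat) : nat := \max_(1 <= i < n.+1 | mu i <= n) i.

(* Greedy mu-expansion of n: the remainder r and the coefficients
   i |-> epsilon_i. Each round decreases n, so fuel n is enough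
   (see mu_expansionE). *)
Fixpoint mu_greedy (fuel n : nat) : nat * (nat -> nat) :=
  if n <= 4 then (n, fun=> 0) else
  if fuel is fuel'.+1 then
    let l := mu_top n in
    let r' := n - mu l in
    if r' == 0 then (0, fun i => if i == l then 1 else 0)
    else if r' == mu l then (0, fun i => if i == l then 2 else 0)
    else let: (r, eps) := mu_greedy fuel' r' in
         (r, fun i => if i == l then 1 else eps i)
  else (n, fun=> 0).

Definition mu_expansion (n : nat) : nat * (nat -> nat) := mu_greedy n n.

Definition mu_coef (n i : nat) : nat := (mu_expansion n).2 i.

Definition phi (n : nat) : nat := \sum_(1 <= i < (mu_top n).+1) mu_coef n i.

Lemma muE i : mu i = 3 * 2 ^ i - 1.
Proof. by rewrite /mu /M; have : 0 < 2 ^ i; [rewrite expn_gt0|lia]. Qed.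

Lemma muS i : mu i.+1 = (mu i).*2.+1.
Proof. by rewrite !muE expnS; have : 0 < 2 ^ i; [rewrite expn_gt0|lia]. Qed.

Lemma leq_mu i : i <= mu i.
Proof. by rewrite muE; have := ltn_expl i (isT : 1 < 2); lia. Qed.

Lemma mu_top_max n i : 0 < i -> mu i <= n -> i <= mu_top n.
Proof.
move=> i0 mui; rewrite /mu_top; apply: (@leq_bigmax_seq _ _ _ id) => //.
by rewrite mem_index_iota i0 ltnS (leq_trans (leq_mu i)).
Qed.

Lemma mu_topP n : 4 < n -> 0 < mu_top n /\ mu (mu_top n) <= n < mu (mu_top n).+1.
Proof.
move=> n4; have t0 : 0 < mu_top n by apply: (@mu_top_max n 1).
split=> //; apply/andP; split; last first.
  by rewrite ltnNge; apply/negP => /mu_top_max; rewrite ltnn => /(_ isT).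
move: t0; rewrite /mu_top.
apply: (big_ind (fun t => 0 < t -> mu t <= n)) => // x y hx hy.
by rewrite /maxn; case: ifP.
Qed.

Lemma mu_top_small n : n <= 4 -> mu_top n = 0.
Proof.
move=> n4; rewrite /mu_top big_nat_cond big_pred0 // => i.
apply/negbTE/negP => /andP[/andP[i0 _]].
case: i i0 => // i _; rewrite muS.
have : 2 <= mu i by rewrite /mu leq_addl.
lia.
Qed.

Lemma mu_gt0 i : 0 < mu i.
Proof. by rewrite /mu addn2. Qed.

Lemma mu_greedy_fuel f n : n <= f -> mu_greedy f n = mu_greedy n n.
Proof.
elim/ltn_ind: n f => n IH f nf.
case: n IH nf => [|n] IH nf; first by case: f nf.
case: f nf => // f nf; rewrite /=; case: leqP => // n4.
have h : n.+1 - mu (mu_top n.+1) <= n by have := mu_gt0 (mu_top n.+1); lia.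
by rewrite (IH _ _ f) ?(IH _ _ n) // (leq_trans h).
Qed.

Lemma mu_expansionE n : mu_expansion n =
  if n <= 4 then (n, fun=> 0) else
  let l := mu_top n in
  let r' := n - mu l in
  if r' == 0 then (0, fun i => if i == l then 1 else 0)
  else if r' == mu l then (0, fun i => if i == l then 2 else 0)
  else let: (r, eps) := mu_expansion r' in
       (r, fun i => if i == l then 1 else eps i).
Proof.
case: n => // n; rewrite /mu_expansion [LHS]/=; case: leqP => // n4 /=.
rewrite mu_greedy_fuel //; have := mu_gt0 (mu_top n.+1); lia.
Qed.

Lemma mu_expansion_sum n :
  n = (mu_expansion n).1
      + \sum_(1 <= i < (mu_top n).+1) mu_coef n i * mu i.
Proof.
rewrite /mu_coef; elim/ltn_ind: n => n IH; rewrite mu_expansionE.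
case: leqP => n4; first by rewrite mu_top_small // big_geq // addn0.
have [l0 /andP[ln nl]] := mu_topP n4; rewrite muS in nl.
set l := mu_top n in l0 ln nl *; cbv zeta.
have sumE (c : nat) (e : nat -> nat) :
    \sum_(1 <= i < l.+1) (if i == l then c else e i) * mu i
    = \sum_(1 <= i < l) e i * mu i + c * mu l.
  rewrite big_nat_recr //= eqxx; congr (_ + _).
  by apply: eq_big_nat => i /andP[_ il]; rewrite ltn_eqF.
have sum0 : \sum_(1 <= i < l) 0 * mu i = 0 by rewrite big1.
case: eqP => [r0|r0] /=; first by rewrite (sumE 1 (fun=> 0)) sum0; lia.
case: eqP => [rl|rl] /=; first by rewrite (sumE 2 (fun=> 0)) sum0; lia.
have rn : n - mu l < n by have := mu_gt0 l; lia.
have := IH _ rn.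
case E: (mu_expansion (n - mu l)) => [r e] /= IHr.
rewrite sumE.
have tl : mu_top (n - mu l) < l.
  have [r4|r4] := leqP (n - mu l) 4; first by rewrite mu_top_small.
  have [t0 /andP[tr _]] := mu_topP r4.
  rewrite ltnNge; apply/negP => lt.
  have : mu l <= mu (mu_top (n - mu l)).
    by move: (mu_top _) lt => t lt; rewrite !muE leq_sub2r // leq_mul2l leq_exp2l.
  lia.
have zero i : mu_top (n - mu l) < i -> e i = 0.
  have -> : e = (mu_expansion (n - mu l)).2 by rewrite E.
  elim/ltn_ind: (n - mu l) {E IHr tl rn r0 rl} i => k IHk i ti.
  rewrite mu_expansionE; case: leqP => // k4; cbv zeta.
  have [t0 /andP[tk kt]] := mu_topP k4.
  have til : (i == mu_top k) = false by rewrite gtn_eqF.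
  case: eqP => [_|_] /=; first by rewrite til.
  case: eqP => [_|_] /=; first by rewrite til.
  have rk : k - mu (mu_top k) < k by have := mu_gt0 (mu_top k); lia.
  have := IHk _ rk i.
  case: (mu_expansion _) => r' e' /=; rewrite til; apply.
  apply: leq_trans ti; rewrite ltnS.
  have [r4|r4] := leqP (k - mu (mu_top k)) 4; first by rewrite mu_top_small.
  have [u0 /andP[ur _]] := mu_topP r4.
  by apply: mu_top_max => //; apply: leq_trans ur (leq_subr _ _).
have -> : \sum_(1 <= i < l) e i * mu i
        = \sum_(1 <= i < (mu_top (n - mu l)).+1) e i * mu i.
  rewrite (big_cat_nat _ (n := (mu_top (n - mu l)).+1)) //=.
  rewrite [X in _ + X]big_nat_cond [X in _ + X]big1 ?addn0 //.
  by move=> i /andP[/andP[ti _] _]; rewrite zero.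
lia.
Qed.

(* Main.v *)
Require Import Defs.
From mathcomp Require Import all_boot all_order all_algebra.
From mathcomp Require Import zify.

(** Replacing every [mu i = 3 * M i + 2] by [M i] in the expansion of [m], and
    dropping the remainder, yields [s_inv m]; so [r] is that remainder. The
    reason is self-similarity: the block [A_l] has length [M l] and sum [mu l],
    and [A_(l+1)] is two copies of it followed by a [1]. Hence
    [s (M l + j) = mu l + s j] for [j <= M l], and removing the greedy term
    [mu l] from [m] lowers [s_inv m] by [M l]; the trailing [1] makes this hold
    up to and including [m = 2 * mu l], the case of a coefficient [2]. *)

Lemma MS i : M i.+1 = (M i).*2.+1.
Proof. by rewrite /M expnS; have : 0 < 2 ^ i; [rewrite expn_gt0 | lia]. Qed.

Lemma leq_mu_mono : {mono mu : i j / i <= j}.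
Proof.
apply: leq_mono; apply: homo_ltn => [|i]; first exact: ltn_trans.
by rewrite muS; lia.
Qed.

Lemma ltn_mu_mono : {mono mu : i j / i < j}.
Proof. exact: leqW_mono leq_mu_mono. Qed.

Lemma s0 : s 0 = 0.
Proof. by rewrite /s big_nat1. Qed.

Lemma sS n : s n.+1 = s n + a n.+1.
Proof. by rewrite /s big_nat_recr. Qed.

Lemma leq_s_mono : {mono s : i j / i <= j}.
Proof.
apply: leq_mono; apply: homo_ltn => [|i]; first exact: ltn_trans.
by rewrite sS -[ltnLHS]addn0 ltn_add2l a_gt0.
Qed.

Lemma s_take_blockA k n : n <= M k -> s n = sumn (take n (blockA k)).
Proof.
rewrite /M -size_blockA; elim: n => [|n IHn] nk; first by rewrite s0 take0.
by rewrite sS IHn 1?ltnW // (@a_blockA k) ?nk // (take_nth 0) // sumn_rcons.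
Qed.

Lemma sumn_blockA k : 0 < k -> sumn (blockA k) = mu k.
Proof.
case: k => // k _; elim: k => [|k IHk] //.
by rewrite blockASS !sumn_cat IHk [RHS]muS /=; lia.
Qed.

Lemma s_M l : 0 < l -> s (M l) = mu l.
Proof.
move=> l0; rewrite (s_take_blockA l) // -sumn_blockA //.
by rewrite take_oversize // size_blockA.
Qed.

Lemma s_M_add l j : 0 < l -> j <= M l -> s (M l + j) = mu l + s j.
Proof.
case: l => // l _ jl.
have size_l : size (blockA l.+1) = M l.+1 := size_blockA _.
rewrite (s_take_blockA l.+2); last by rewrite [M l.+2]MS; lia.
rewrite blockASS take_cat size_l ltnNge leq_addr addKn sumn_cat sumn_blockA //.
by rewrite takel_cat ?size_l // -s_take_blockA.
Qed.

Lemma leq_s_inv n m : (n <= s_inv m) = (s n <= m).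
Proof.
rewrite /s_inv; case: ex_maxnP => k sk k_max.
by apply/idP/idP => [|/k_max //]; rewrite -leq_s_mono => /leq_trans; apply.
Qed.

Lemma s_inv_eq m n : (s_inv m == n) = (s n <= m < s n.+1).
Proof. by rewrite eqn_leq -ltnS ltnNge !leq_s_inv -ltnNge andbC. Qed.

Lemma s_inv_small m : m <= 4 -> s_inv m = 0.
Proof. by move=> m4; apply/eqP; rewrite s_inv_eq sS s0. Qed.

Lemma s_inv_mu_add l r : 0 < l -> r <= mu l -> s_inv (mu l + r) = M l + s_inv r.
Proof.
move=> l0 rl; have := eqxx (s_inv r); rewrite s_inv_eq => /andP[s_le s_gt].
have inv_le : s_inv r <= M l by rewrite -leq_s_mono s_M // (leq_trans s_le).
apply/eqP; rewrite s_inv_eq s_M_add // leq_add2l s_le -[(M l + _).+1]addnS /=.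
move: inv_le; rewrite leq_eqVlt => /predU1P[->|inv_lt]; last first.
  by rewrite s_M_add // ltn_add2l.
by rewrite addnS addnn -MS s_M // muS ltnS -addnn leq_add2l.
Qed.

Lemma leq_mu_top n i : 0 < i -> (i <= mu_top n) = (mu i <= n).
Proof.
move=> i0; apply/idP/idP => [it|]; last exact: mu_top_max.
have [n4|n4] := leqP n 4; first by move: it; rewrite mu_top_small // leqNgt i0.
have [_ /andP[top_le _]] := mu_topP n4.
by apply: leq_trans top_le; rewrite leq_mu_mono.
Qed.

Lemma mu_top_mu_add l r : 0 < l -> r <= mu l -> mu_top (mu l + r) = l.
Proof.
move=> l0 rl; apply/eqP; rewrite eqn_leq leq_mu_top // leq_addr andbT.
by rewrite -ltnS ltnNge leq_mu_top // -ltnNge muS ltnS -addnn leq_add2l.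
Qed.

Lemma mu_gt4 l : 0 < l -> 4 < mu l.
Proof. by rewrite -leq_mu_mono. Qed.

Lemma mu_greedy_ind (P : nat -> Prop) :
  (forall n, n <= 4 -> P n) ->
  (forall l r, 0 < l -> r <= mu l -> P r -> P (mu l + r)) ->
  forall n, P n.
Proof.
move=> Psmall Padd; elim/ltn_ind => n IHn.
have [/Psmall //|n4] := leqP n 4.
have [l0 /andP[ln nl]] := mu_topP n4; rewrite -(subnKC ln).
apply: Padd => //; first by rewrite leq_subLR addnn -ltnS -muS.
by apply: IHn; rewrite ltn_subrL mu_gt0 (leq_trans _ n4).
Qed.

Lemma mu_expansion_mu_add l r : 0 < l -> r <= mu l ->
  mu_expansion (mu l + r) =
    if r == 0 then (0, fun i => if i == l then 1 else 0)
    else if r == mu l then (0, fun i => if i == l then 2 else 0)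
    else ((mu_expansion r).1, fun i => if i == l then 1 else mu_coef r i).
Proof.
move=> l0 rl; rewrite mu_expansionE leqNgt ltn_addr ?mu_gt4 //=.
by rewrite mu_top_mu_add // addKn /mu_coef; case: (mu_expansion r).
Qed.

Lemma mu_remainder_leq4 n : (mu_expansion n).1 <= 4.
Proof.
elim/mu_greedy_ind: n => [n n4|l r l0 rl IHr].
  by rewrite mu_expansionE n4.
by rewrite mu_expansion_mu_add //; case: ifP => // _; case: ifP.
Qed.

Lemma mu_coef_small n i : n <= 4 -> mu_coef n i = 0.
Proof. by move=> n4; rewrite /mu_coef mu_expansionE n4. Qed.

Lemma mu_coef_mu l i : 0 < l -> mu_coef (mu l) i = (i == l).
Proof.
by move=> l0; rewrite -[mu l]addn0 /mu_coef mu_expansion_mu_add //=; case: eqP.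
Qed.

Lemma mu_coef_mu_add_neq l r i : 0 < l -> r <= mu l -> i != l ->
  mu_coef (mu l + r) i = mu_coef r i.
Proof.
move=> l0 rl /negPf il; rewrite {1}/mu_coef mu_expansion_mu_add //.
case: eqP => [->|_] /=; first by rewrite il mu_coef_small.
by case: eqP => [->|_] /=; rewrite il // mu_coef_mu // il.
Qed.

Lemma mu_coef_eq0 n i : n < mu i -> mu_coef n i = 0.
Proof.
elim/mu_greedy_ind: n => [n n4 _|l r l0 rl IHr lri]; first exact: mu_coef_small.
have li : l < i by rewrite -ltn_mu_mono (leq_ltn_trans (leq_addr r _)).
rewrite mu_coef_mu_add_neq ?gtn_eqF // IHr //.
exact: leq_ltn_trans (leq_addl (mu l) r) lri.
Qed.

Lemma mu_coef_mu_add l r i : 0 < l -> r <= mu l ->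
  mu_coef (mu l + r) i = (i == l) + mu_coef r i.
Proof.
move=> l0 rl; have [->|il] := eqVneq i l; last exact: mu_coef_mu_add_neq.
have [->|r_neq] := eqVneq r (mu l).
  rewrite mu_coef_mu // eqxx /mu_coef mu_expansion_mu_add //.
  by rewrite !eqxx gtn_eqF ?mu_gt0 //= eqxx.
rewrite (mu_coef_eq0 r) ?ltn_neqAle ?r_neq // /mu_coef mu_expansion_mu_add //.
by rewrite (negPf r_neq); case: ifP => /=; rewrite eqxx.
Qed.

Definition mu_weight (w : nat -> nat) (n : nat) : nat :=
  \sum_(1 <= i < (mu_top n).+1) mu_coef n i * w i.

Lemma mu_weightE w n k : n < mu k.+1 ->
  mu_weight w n = \sum_(1 <= i < k.+1) mu_coef n i * w i.
Proof.
move=> nk.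
have tk : mu_top n <= k by rewrite -ltnS ltnNge leq_mu_top // -ltnNge.
rewrite [RHS](big_cat_nat (n := (mu_top n).+1)) //=.
rewrite [X in _ + X]big_nat_cond [X in _ + X]big1 ?addn0 // => i.
case/andP=> /andP[ti _] _; rewrite mu_coef_eq0 //.
by rewrite ltnNge -leq_mu_top ?(leq_trans _ ti) // -ltnNge.
Qed.

Lemma mu_weight_small w n : n <= 4 -> mu_weight w n = 0.
Proof. by move=> n4; rewrite /mu_weight mu_top_small // big_geq. Qed.

Lemma mu_weight_mu_add w l r : 0 < l -> r <= mu l ->
  mu_weight w (mu l + r) = w l + mu_weight w r.
Proof.
move=> l0 rl.
have lr_lt : mu l + r < mu l.+1 by rewrite muS ltnS -addnn leq_add2l.
rewrite !(mu_weightE _ _ l) ?(leq_ltn_trans (leq_addl (mu l) r)) //.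
under eq_bigr => i _ do rewrite mu_coef_mu_add // mulnDl.
rewrite big_split /=; congr (_ + _); rewrite big_nat_recr //= eqxx mul1n.
rewrite big_nat_cond big1 // => i /andP[/andP[_ il] _].
by rewrite ltn_eqF.
Qed.

Lemma s_inv_mu_weight m : s_inv m = mu_weight M m.
Proof.
elim/mu_greedy_ind: m => [m m4|l r l0 rl IHr].
  by rewrite s_inv_small ?mu_weight_small.
by rewrite s_inv_mu_add // mu_weight_mu_add // IHr.
Qed.

Lemma mu_weight_mu n : mu_weight mu n = 3 * mu_weight M n + 2 * phi n.
Proof.
rewrite /mu_weight /phi !big_distrr -big_split /=.
by apply: eq_bigr => i _; rewrite /mu mulnDr mulnCA [2 * _]mulnC.
Qed.

Theorem theorem5p1 (m : nat) (hm : 0 < m) :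
  exists r : nat,
    r <= 4 /\
    (m%:Z - r%:Z = 3%:Z * (s_inv m)%:Z + 2%:Z * (phi m)%:Z)%R.
Proof.
exists (mu_expansion m).1; split; first exact: mu_remainder_leq4.
have := mu_expansion_sum m; rewrite -/(mu_weight mu m) mu_weight_mu.
rewrite -s_inv_mu_weight; lia.
Qed.
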